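(* Let $n=2$ and let the cost structure be separable. For any $\theta_0\in[0,1)$, the left-censored outcome and quality functions with threshold $\theta_0$ can be implemented by a score ceiling auction with score $S(q,p)=q-p$, score ceiling $\bar S=S^*_{sym}(\theta_0)$ and kickback $$K=\max_q[V(q)-g(q)]-\max_q\Big[V(q)-\frac{g(q)}{1-F(\theta_0)}\Big]+\alpha\frac{F(\theta_0)}{1-F(\theta_0)}\int_{\theta_0}^1(1-F(u))\,du,$$ with equilibrium score strategies $S^*_i(\theta)=\min\{S^*_{sym}(\theta),\bar S\}$ for both firms. That is, these score strategies together with the left-censored quality functions form a Bayes--Nash equilibrium of the auction with non-negative interim expected profits, and they induce the left-censored allocation.
   Context: Setting. A buyer procures one contract from two firms $i=1,2$ (firm 1 is ''favored''). Types $\theta_i\in[0,1]$ are private, i.i.d. with cdf $F$ and strictly positive density $f$; $J(\theta)=\theta+F(\theta)/f(\theta)$ is strictly increasing. Separable cost structure: the buyer's value of quality is $V(q)=q$, production (winner-pay) cost $C^P(q,\theta)=\alpha\theta$ with $\alpha>0$, investment (all-pay) cost $C^I(q,\theta)=g(q)$ with $g(0)=g'(0)=0$, $g'(q)>0$ and $g''(q)>0$ for $q>0$, and $g'(q)>1$ for all large $q$. Each firm, knowing only its own type, chooses quality $q_i\ge0$ and a price $m_i\in\mathbb R$; its profit is $t_i-\alpha\theta_iz_i-g(q_i)$. A Bayes--Nash equilibrium requires that (almost) every type's (quality, price) choice maximizes interim expected profit over all pairs $(q',m')$. Choosing $(q,m)$ is equivalent to choosing $(q,S)$ with score $S=q-m$.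 Score ceiling auction with ceiling $\bar S$ and kickback $K$, where $S_i=q_i-m_i$: $z_1=\mathbb I(\bar S\ge S_1\ge S_2)$, $t_1=m_1z_1-K\,\mathbb I(\bar S=S_1\ge S_2)$, $z_2=\mathbb I(\bar S\ge S_2>S_1)$, $t_2=m_2z_2$. Notation: $q^*_{sym}(\theta)=(g')^{-1}(1-F(\theta))$; $IR(\theta,\theta')=\alpha\int_\theta^{\theta'}(1-F(u))\,du$; $S^*_{sym}(\theta)=q^*_{sym}(\theta)-\alpha\theta-\dfrac{g(q^*_{sym}(\theta))+IR(\theta,1)}{1-F(\theta)}$ for $\theta<1$. Left-censored functions with threshold $\theta_0$: with $\tilde\theta_2=\max(\theta_0,\theta_2)$, $z_2(\bm\theta)=\mathbb I(\tilde\theta_2<\theta_1)$, $z_1=1-z_2$, $q_2(\theta_2)=q^*_{sym}(\tilde\theta_2)$, and $q_1(\theta_1)=q^*_{sym}(\theta_1)$ if $\theta_1>\theta_0$, $q_1(\theta_1)=q^*_{sym}(0)$ if $\theta_1<\theta_0$ (allocations understood up to null sets of types). *)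

(* Defs.v *)
From HB Require Import structures.
From mathcomp Require Import all_boot all_order all_algebra.
From mathcomp Require Import all_classical all_reals all_analysis.

Set Implicit Arguments.
Unset Strict Implicit.
Unset Printing Implicit Defensive.

Import Order.TTheory GRing.Theory Num.Theory.
Import numFieldNormedType.Exports.

Local Open Scope classical_set_scope.
Local Open Scope ring_scope.

Definition type_space (R : realType) : set R := `[0, 1].

(* [P] is the common law of the types.  Applied to [A = setT], the second
   clause says that [f] integrates to 1 over [0, 1]; in particular [P] is
   carried by [0, 1]. *)
Definition type_density (R : realType) (P : probability (measurableTypeR R) R)
    (f : R -> R) : Prop :=
  [/\ measurable_fun (@type_space R) f,
      (forall A : set R, measurable A ->
         P A = \int[lebesgue_measure]_(x in A `&` @type_space R) (f x)%:E)%E &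
      forall x : R, 0 <= x <= 1 -> 0 < f x].

Definition type_cdf (R : realType) (P : probability (measurableTypeR R) R)
    (x : R) : R :=
  fine (P `]-oo, x]%classic).

Definition virtual_cost (R : realType)
    (P : probability (measurableTypeR R) R) (f : R -> R) (x : R) : R :=
  x + type_cdf P x / f x.

Definition regular_types (R : realType)
    (P : probability (measurableTypeR R) R) (f : R -> R) : Prop :=
  {in `[0, 1] &, {homo virtual_cost P f : x y / x < y}}.

(* [dg] and [ddg] are g' and g''.  Qualities are non-negative, so [g], [dg] and
   [ddg] are unconstrained on negative reals, and g'(0) is a right
   derivative. *)
Record investment_cost (R : realType) (g dg ddg : R -> R) : Prop := {
  icost_0 : g 0 = 0;
  icost_d0 : dg 0 = 0;
  icost_right_derivative0 : h^-1 * (g h - g 0) @[h --> 0^'+] --> dg 0;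
  icost_derive : forall q : R, 0 < q -> is_derive q 1 g (dg q);
  icost_derive2 : forall q : R, 0 < q -> is_derive q 1 dg (ddg q);
  icost_d_gt0 : forall q : R, 0 < q -> 0 < dg q;
  icost_dd_gt0 : forall q : R, 0 < q -> 0 < ddg q;
  icost_d_large : exists Q : R, forall q : R, Q < q -> 1 < dg q
}.

(* (quality, price) *)
Definition offer (R : realType) : Type := (R * R)%type.

Definition score (R : realType) (b : offer R) : R := b.1 - b.2.

Record auction (R : realType) := Auction {
  win1 : offer R -> offer R -> bool;
  win2 : offer R -> offer R -> bool;
  pay1 : offer R -> offer R -> R;
  pay2 : offer R -> offer R -> R
}.

Section ScoreCeilingAuction.
Context (R : realType) (Sbar K : R).

Definition ceiling_win1 (b1 b2 : offer R) : bool :=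
  score b2 <= score b1 <= Sbar.

Definition ceiling_win2 (b1 b2 : offer R) : bool :=
  score b1 < score b2 <= Sbar.

Definition pays_kickback (b1 b2 : offer R) : bool :=
  (Sbar == score b1) && (score b2 <= score b1).

Definition score_ceiling_auction : auction R :=
  {| win1 := ceiling_win1;
     win2 := ceiling_win2;
     pay1 := fun b1 b2 =>
       b1.2 * (ceiling_win1 b1 b2)%:R - K * (pays_kickback b1 b2)%:R;
     pay2 := fun b1 b2 => b2.2 * (ceiling_win2 b1 b2)%:R |}.

End ScoreCeilingAuction.

Section Equilibrium.
Context (R : realType) (P : probability (measurableTypeR R) R).
Context (g : R -> R) (alpha : R) (M : auction R).

Definition profit1 (theta : R) (b1 b2 : offer R) : R :=
  pay1 M b1 b2 - alpha * theta * (win1 M b1 b2)%:R - g b1.1.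

Definition profit2 (theta : R) (b1 b2 : offer R) : R :=
  pay2 M b1 b2 - alpha * theta * (win2 M b1 b2)%:R - g b2.1.

(* Expected profit of a firm of type [theta] making the offer [b] against the
   opponent's strategy. *)
Definition interim_profit1 (sigma2 : R -> offer R) (theta : R) (b : offer R)
    : R :=
  \int[P]_(theta2 in @type_space R) profit1 theta b (sigma2 theta2).

Definition interim_profit2 (sigma1 : R -> offer R) (theta : R) (b : offer R)
    : R :=
  \int[P]_(theta1 in @type_space R) profit2 theta (sigma1 theta1) b.

(* Measurability of the strategies ensures that expected profits make sense. *)
Definition bayes_nash_equilibrium (sigma1 sigma2 : R -> offer R) : Prop :=
  [/\ measurable_fun (@type_space R) sigma1,
      measurable_fun (@type_space R) sigma2,
      {ae P, forall theta : R, 0 <= (sigma1 theta).1 /\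
         forall b : offer R, 0 <= b.1 ->
           interim_profit1 sigma2 theta b
             <= interim_profit1 sigma2 theta (sigma1 theta)} &
      {ae P, forall theta : R, 0 <= (sigma2 theta).1 /\
         forall b : offer R, 0 <= b.1 ->
           interim_profit2 sigma1 theta b
             <= interim_profit2 sigma1 theta (sigma2 theta)}].

Definition interim_individually_rational (sigma1 sigma2 : R -> offer R)
    : Prop :=
  {ae P, forall theta : R,
     0 <= interim_profit1 sigma2 theta (sigma1 theta)} /\
  {ae P, forall theta : R,
     0 <= interim_profit2 sigma1 theta (sigma2 theta)}.

Definition induces_outcome (sigma1 sigma2 : R -> offer R)
    (z1 z2 : R -> R -> bool) : Prop :=
  {ae (P \x P)%E, forall th : R * R,
     win1 M (sigma1 th.1) (sigma2 th.2) = z1 th.1 th.2 /\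
     win2 M (sigma1 th.1) (sigma2 th.2) = z2 th.1 th.2}.

End Equilibrium.

Definition strategy_of (R : realType) (q S : R -> R) (theta : R) : offer R :=
  (q theta, q theta - S theta).

(* The maximum of [h] over qualities [q >= 0] (junk value 0 if not attained). *)
Definition max_quality (R : realType) (h : R -> R) : R :=
  xget 0 [set m | (exists2 q : R, 0 <= q & h q = m) /\
                  forall q : R, 0 <= q -> h q <= m].

Section SymmetricFunctions.
Context (R : realType) (P : probability (measurableTypeR R) R).
Context (g dg : R -> R) (alpha : R).
Local Notation F := (type_cdf P).

(* Inverse of g' on [0, +oo[. *)
Definition marginal_cost_inv (y : R) : R :=
  xget 0 [set q : R | 0 <= q /\ dg q = y].

Definition q_sym (theta : R) : R := marginal_cost_inv (1 - F theta).

(* Meant for [x <= y]. *)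
Definition info_rent (x y : R) : R :=
  alpha * \int[lebesgue_measure]_(u in `[x, y]) (1 - F u).

(* Meant for [theta < 1]. *)
Definition S_sym (theta : R) : R :=
  q_sym theta - alpha * theta
  - (g (q_sym theta) + info_rent theta 1) / (1 - F theta).

Definition S_star (Sbar theta : R) : R := Num.min (S_sym theta) Sbar.

Definition kickback (theta0 : R) : R :=
  max_quality (fun q => q - g q)
  - max_quality (fun q => q - g q / (1 - F theta0))
  + alpha * (F theta0 / (1 - F theta0))
    * \int[lebesgue_measure]_(u in `[theta0, 1]) (1 - F u).

Definition lc_win2 (theta0 theta1 theta2 : R) : bool :=
  Num.max theta0 theta2 < theta1.

Definition lc_win1 (theta0 theta1 theta2 : R) : bool :=
  ~~ lc_win2 theta0 theta1 theta2.

Definition lc_quality2 (theta0 theta2 : R) : R :=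
  q_sym (Num.max theta0 theta2).

(* The value of [q1] at the threshold is left free. *)
Definition lc_quality1 (theta0 : R) (q1 : R -> R) : Prop :=
  forall theta1 : R, 0 <= theta1 <= 1 ->
    (theta0 < theta1 -> q1 theta1 = q_sym theta1) /\
    (theta1 < theta0 -> q1 theta1 = q_sym 0).

End SymmetricFunctions.

(* Main.v *)
(* A firm of type [th] that makes the offer [(q_sym t, S_sym t)] and outbids
   exactly the types above [t] earns
     U(t, th) = alpha ((1 - F t) (t - th) + int_t^1 (1 - F)),
   because [q_sym t] maximises [(1 - F t) q - g q]; the maximum of [U(., th)]
   over [t >= theta0] is at [max theta0 th].  A score [s] below the ceiling
   outbids an upper set of types, and for each [x] in that set [S_sym x <= s]
   bounds [(1 - F x) (q - s - alpha th) - g q] by [U(x, th)]; the winning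
   probability is the supremum of these [1 - F x], so no deviation below the
   ceiling earns more than [U(max theta0 th, th)].  At the ceiling the favored
   firm wins for sure, and the kickback is such that its best profit there is
   [alpha (theta0 - th + int_theta0^1 (1 - F))], which is at least
   [U(theta0, th)] for [th <= theta0] and at most [U(th, th)] for
   [th >= theta0]. *)

Require Import Defs.
From HB Require Import structures.
From mathcomp Require Import all_boot all_order all_algebra.
From mathcomp Require Import all_classical all_reals all_analysis.
From mathcomp Require Import measurable_realfun.
From mathcomp Require Import lra ring.

Set Implicit Arguments.
Unset Strict Implicit.
Unset Printing Implicit Defensive.

Import Order.TTheory GRing.Theory Num.Theory.
Import numFieldNormedType.Exports.

Local Open Scope classical_set_scope.
Local Open Scope ring_scope.

(** * Convexity of the investment cost and inversion of its derivative *)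

Section InvestmentCost.
Context (R : realType) (g dg ddg : R -> R) (Hg : investment_cost g dg ddg).

Lemma icost_within_continuous (a b : R) :
  0 <= a -> a < b -> {within `[a, b], continuous g}.
Proof.
move=> a0 ab.
have cg x : 0 < x -> {for x, continuous g}.
  by move=> x0; apply/differentiable_continuous/derivable1_diffP;
    case: (icost_derive Hg x0).
apply/continuous_within_itvP => //; split.
- by move=> x; rewrite in_itv/= => /andP[ax _]; apply: cg; exact: le_lt_trans ax.
- move: a0; rewrite le_eqVlt => /predU1P[<-|a0]; last first.
    by apply: cvg_at_right_filter; exact: cg.
  have h0 : (h : R) @[h --> 0^'+] --> (0 : R).
    by apply: cvg_at_right_filter; exact: cvg_id.
  (* At 0 only the right difference quotient is known to converge; multiplying it by [h] gives right
     continuity. *)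
  have gh : h * (h^-1 * (g h - g 0)) @[h --> 0^'+] --> 0 * dg 0.
    exact: cvgM h0 (icost_right_derivative0 Hg).
  have : h * (h^-1 * (g h - g 0)) + g 0 @[h --> 0^'+] --> 0 * dg 0 + g 0.
    by apply: cvgD gh _; exact: cvg_cst.
  rewrite mul0r add0r; apply: cvg_trans; apply: near_eq_cvg; near=> h.
  have h0' : h != 0 by rewrite gt_eqF//; near: h; exact: nbhs_right_gt.
  by rewrite mulVKf// subrK.
- by apply: cvg_at_left_filter; apply: cg; exact: le_lt_trans ab.
Unshelve. all: by end_near. Qed.

Lemma icost_mean_value (a b : R) : 0 <= a -> a < b ->
  exists2 c, a < c < b & g b - g a = dg c * (b - a).
Proof.
move=> a0 ab; have dgx x : x \in `]a, b[%R -> is_derive x 1 g (dg x).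
  rewrite in_itv/= => /andP[ax _]; apply: (icost_derive Hg).
  exact: le_lt_trans ax.
have [c] := MVT ab dgx (icost_within_continuous a0 ab).
by rewrite in_itv/=; exists c.
Qed.

Lemma icost_d_within_continuous (a b : R) :
  0 < a -> {within `[a, b], continuous dg}.
Proof.
move=> a0; apply: derivable_within_continuous => x.
rewrite in_itv/= => /andP[ax _].
by case: (icost_derive2 Hg (lt_le_trans a0 ax)).
Qed.

(** The mean value theorem applies away from 0, where [dg] is differentiable. Continuity of [dg] at
    0 is not assumed, so the case [a = 0] rests on the sign of [dg]. *)
Lemma icost_d_le (a b : R) : 0 <= a -> a <= b -> dg a <= dg b.
Proof.
rewrite le_eqVlt => /predU1P[<-|a0].
  rewrite le_eqVlt => /predU1P[->//|b0].
  by rewrite (icost_d0 Hg) ltW// (icost_d_gt0 Hg).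
move=> ab.
have ddgx x : x \in `]a, b[%R -> is_derive x 1 dg (ddg x).
  rewrite in_itv/= => /andP[ax _]; apply: (icost_derive2 Hg).
  exact: lt_trans ax.
have [c] := MVT_segment ab ddgx (@icost_d_within_continuous a b a0).
rewrite in_itv/= => /andP[ac _] e; rewrite -subr_ge0 e mulr_ge0 ?subr_ge0//.
by rewrite ltW// (icost_dd_gt0 Hg)// (lt_le_trans a0).
Qed.

(** Difference quotients at 0 tend to 0, and each is a value of [dg] at an interior point. This
    supplies the left end point when inverting [dg] by intermediate values. *)
Lemma icost_d_small (y : R) : 0 < y -> exists2 q, 0 < q & dg q < y.
Proof.
move=> y0.
have /filter_ex[h [hy h0]] :
    \forall h \near 0^'+, h^-1 * (g h - g 0) < y /\ 0 < h.
  near=> h; split; last by near: h; exact: nbhs_right_gt.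
  near: h; have := icost_right_derivative0 Hg; rewrite (icost_d0 Hg).
  by move=> /cvgr_lt; exact.
have [c /andP[c0 _] e] := icost_mean_value (lexx _) h0; exists c => //.
by move: hy; rewrite e subr0 mulrC mulfK ?gt_eqF.
Unshelve. all: by end_near. Qed.

(** Convexity: the slope of the chord is a value of [dg] between [p] and [q], compared with [dg p]
    by monotonicity. *)
Lemma icost_tangent (p q : R) :
  0 <= p -> 0 <= q -> g p + dg p * (q - p) <= g q.
Proof.
move=> p0 q0; have [pq|qp|->] := ltgtP p q; last by rewrite subrr mulr0 addr0.
- have [c /andP[pc cq] e] := icost_mean_value p0 pq.
  rewrite addrC -lerBrDr e ler_wpM2r//; first by rewrite subr_ge0 ltW.
  by apply: icost_d_le => //; exact: ltW.
- have [c /andP[qc cp] e] := icost_mean_value q0 qp.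
  rewrite -lerBrDl -opprB -[leRHS]opprB mulrN lerN2 e ler_wpM2r//.
    by rewrite subr_ge0 ltW.
  by apply: icost_d_le; [exact/ltW/(le_lt_trans q0)|exact: ltW].
Qed.

Lemma icost_gt0 (q : R) : 0 < q -> 0 < g q.
Proof.
move=> q0; have [c /andP[c0 _]] := icost_mean_value (lexx _) q0.
by rewrite (icost_0 Hg) !subr0 => ->; rewrite mulr_gt0// (icost_d_gt0 Hg).
Qed.

Lemma icost_ge0 (q : R) : 0 <= q -> 0 <= g q.
Proof.
by rewrite le_eqVlt => /predU1P[<-|/icost_gt0/ltW//]; rewrite (icost_0 Hg).
Qed.

Lemma marginal_cost_invP (y : R) : 0 <= y <= 1 ->
  0 <= marginal_cost_inv dg y /\ dg (marginal_cost_inv dg y) = y.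
Proof.
move=> /andP[y0 y1]; rewrite /marginal_cost_inv.
suff [q [q0 qy]] : exists q, 0 <= q /\ dg q = y.
  by apply: (@xgetI _ _ [set q | 0 <= q /\ dg q = y] q).
move: y0; rewrite le_eqVlt => /predU1P[<-|y0].
  by exists 0; rewrite (icost_d0 Hg).
have [a a0 ay] := icost_d_small y0.
have [Q HQ] := icost_d_large Hg.
(* Beyond [Q] the derivative exceeds 1, hence [y]; the maximum keeps [a <= b]. *)
pose b := Num.max a (Q + 1).
have ab : a <= b by rewrite le_max lexx.
have yb : y < dg b by rewrite (le_lt_trans y1)// HQ// lt_max ltrDl ltr01 orbT.
have [||c] := @IVT R dg a b y ab; first exact: icost_d_within_continuous.
  by rewrite ge_min le_max (ltW ay) (ltW yb) orbT.
rewrite in_itv/= => /andP[ac _] <-; exists c; split => //.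
by rewrite (le_trans _ ac)// ltW.
Qed.

Lemma marginal_cost_inv_ge0 (y : R) : 0 <= y <= 1 ->
  0 <= marginal_cost_inv dg y.
Proof. by case/marginal_cost_invP. Qed.

Lemma marginal_cost_inv_gt0 (y : R) : 0 < y <= 1 ->
  0 < marginal_cost_inv dg y.
Proof.
move=> /andP[y0 y1]; have [|] := @marginal_cost_invP y; first by rewrite ltW.
rewrite le_eqVlt => /predU1P[<-|//]; rewrite (icost_d0 Hg) => e.
by rewrite -e ltxx in y0.
Qed.

Lemma marginal_cost_inv0 : marginal_cost_inv dg 0 = 0.
Proof.
have [|] := @marginal_cost_invP 0; first by rewrite lexx ler01.
rewrite le_eqVlt => /predU1P[<-//|/(icost_d_gt0 Hg) + e].
by rewrite e ltxx.
Qed.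

Lemma marginal_cost_inv_le (x y : R) : 0 <= x -> x <= y -> y <= 1 ->
  marginal_cost_inv dg x <= marginal_cost_inv dg y.
Proof.
move=> x0; rewrite le_eqVlt => /predU1P[->//|xy] y1.
have [|px dx] := @marginal_cost_invP x; first by rewrite x0 ltW// (lt_le_trans xy).
have [|py dy] := @marginal_cost_invP y; first by rewrite y1 (le_trans x0)// ltW.
rewrite leNgt; apply/negP => /ltW /(icost_d_le py).
by rewrite dx dy leNgt xy.
Qed.

Lemma marginal_cost_inv_max (y q : R) : 0 <= y <= 1 -> 0 <= q ->
  y * q - g q <= y * marginal_cost_inv dg y - g (marginal_cost_inv dg y).
Proof.
move=> /marginal_cost_invP[p0 dp] q0.
by have := icost_tangent p0 q0; rewrite dp; lra.
Qed.

End InvestmentCost.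

(** * The type distribution: its cdf, null sets and interval probabilities *)

Section TypeDistribution.
Context (R : realType) (P : probability (measurableTypeR R) R) (f : R -> R).
Context (Hf : type_density P f).
Local Notation F := (type_cdf P).
Local Notation mu := (@lebesgue_measure R).

Lemma measurable_type_space : measurable (@type_space R).
Proof. exact: measurable_itv. Qed.

Lemma type_cdfE (x : R) : (F x)%:E = P `]-oo, x]%classic.
Proof. by rewrite fineK// fin_num_measure. Qed.

Lemma type_cdf_ge0 (x : R) : 0 <= F x.
Proof. by rewrite -lee_fin type_cdfE. Qed.

Lemma type_cdf_le1 (x : R) : F x <= 1.
Proof. by rewrite -lee_fin type_cdfE probability_le1. Qed.

Lemma type_cdf_le (x y : R) : x <= y -> F x <= F y.
Proof.
move=> xy; rewrite -lee_fin !type_cdfE le_measure ?inE//.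
by apply: subset_itvl; rewrite bnd_simp.
Qed.

Lemma measurable_type_cdf (D : set R) : measurable D -> measurable_fun D F.
Proof. by move=> mD; apply: nondecreasing_measurable => // x y; exact: type_cdf_le. Qed.

Lemma type_cdf_right_continuous (x : R) : F y @[y --> x^'+] --> F x.
Proof.
(* [F] is the cdf of the identity random variable, whose law is [P]. *)
pose X : {RV P >-> R} := HB.pack (idfun : measurableTypeR R -> R)
  (@isMeasurableFun.Build _ _ (measurableTypeR R) R idfun (@measurable_id _ _ setT)).
have := @cdf_right_continuous _ _ _ P X x.
have -> : cdf X = EFin \o F by apply/funext => y; rewrite /= type_cdfE.
exact: fine_cvg.
Qed.

Lemma prob_Ntype_space : P (~` @type_space R) = 0%E.
Proof.
case: Hf => _ -> //; last by apply: measurableC; exact: measurable_type_space.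
by rewrite setICl integral_set0.
Qed.

Lemma prob_set1 (x : R) : P [set x] = 0%E.
Proof.
case: Hf => _ -> // _; rewrite (@integral_Sset1 _ _ _ x)//; exact: subIsetl.
Qed.

Lemma prob_type_space : P (@type_space R) = 1%E.
Proof.
rewrite -(setCK (@type_space R)) probability_setC; last first.
  by apply: measurableC; exact: measurable_type_space.
by rewrite prob_Ntype_space sube0.
Qed.

Lemma prob_setI_type_space (A : set R) : measurable A ->
  P (A `&` @type_space R) = P A.
Proof.
by move=> mA; case: Hf => _ HP _; rewrite !HP// -?setIA ?setIid//;
  apply: measurableI => //; exact: measurable_type_space.
Qed.

Lemma prob_itv_oc (x y : R) : x <= y -> P `]x, y]%classic = (F y - F x)%:E.
Proof.
move=> xy; rewrite EFinB !type_cdfE.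
rewrite (@itv_bndbnd_setU _ _ -oo%O (BRight x) (BRight y))//.
rewrite measureU//; last first.
  by rewrite -subset0 => z []/=; rewrite !in_itv/= => zx /andP[/lt_geF]; rewrite zx.
by rewrite addeAC subee ?add0e// fin_num_measure.
Qed.

Lemma type_cdf0 : F 0 = 0.
Proof.
apply: EFin_inj; rewrite type_cdfE -prob_setI_type_space//.
rewrite (_ : _ `&` _ = [set 0]) ?prob_set1//.
apply/seteqP; split => [z []/=|z /= ->]; rewrite /type_space/= !in_itv/=; last first.
  by rewrite lexx ler01.
by move=> z0 /andP[z1 _]; apply/eqP; rewrite eq_le z0.
Qed.

Lemma type_cdf1 : F 1 = 1.
Proof.
apply: EFin_inj; rewrite type_cdfE -prob_setI_type_space// -prob_type_space.
by congr (P _); apply: setIidr; apply: subset_itvr.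
Qed.

(** If [F x = F y], then [f] integrates to 0 over []x, y]] and vanishes almost everywhere there; as
    [f] is positive, an interval of positive length would be null. *)
Lemma type_cdf_lt (x y : R) : 0 <= x -> x < y -> y <= 1 -> F x < F y.
Proof.
move=> x0 xy y1; rewrite -subr_gt0 lt_neqAle subr_ge0 type_cdf_le ?(ltW xy)// andbT.
apply/negP => /eqP F0; have : P `]x, y]%classic = 0%E by rewrite prob_itv_oc ?ltW// -F0.
have sub : `]x, y]%classic `<=` @type_space R.
  move=> z; rewrite /type_space/= !in_itv/= => /andP[xz zy].
  by rewrite (le_trans x0 (ltW xz)) (le_trans zy).
case: Hf => mf HP f0; rewrite HP// setIidl//.
have fpos z : z \in `]x, y]%classic -> 0 < f z.
  by rewrite inE => /sub; rewrite /type_space/= in_itv/=; exact: f0.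
have -> : (\int[mu]_(z in `]x, y]) (f z)%:E = \int[mu]_(z in `]x, y]) `|(f z)%:E|)%E.
  by apply: eq_integral => z /fpos fz; rewrite gee0_abs// lee_fin ltW.
move/ae_eq_integral_abs => /(_ _ _)[]//.
  by apply/measurable_EFinP; apply: measurable_funS mf => //; exact: measurable_type_space.
move=> N [mN N0 sN].
have : (mu `]x, y]%classic <= mu N)%E.
  rewrite le_measure ?inE// => z zxy; apply: sN => /= /(_ zxy) -[].
  by apply/eqP; rewrite gt_eqF// fpos// inE.
by rewrite N0 lebesgue_measure_itv/= lte_fin xy -EFinB lee_fin subr_le0 leNgt xy.
Qed.

Lemma prob_gt (x : R) : 0 <= x <= 1 -> P `]x, 1]%classic = (1 - F x)%:E.
Proof. by move=> /andP[_ x1]; rewrite prob_itv_oc// type_cdf1. Qed.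

Lemma prob_ge (x : R) : 0 <= x <= 1 -> P `[x, 1]%classic = (1 - F x)%:E.
Proof.
move=> /andP[x0 x1]; rewrite -prob_gt ?x0// -(setU1itv false); last by rewrite bnd_simp.
rewrite measureU//; first by have := prob_set1 x => /= ->; rewrite add0e.
by rewrite -subset0 => z [/= ->]; rewrite in_itv/= ltxx.
Qed.

(** * Upper sets of types and integrals of the survival function [1 - F] *)

Lemma measurable_upper_set (X : set R) : X `<=` @type_space R ->
  (forall x y, X x -> x <= y -> y <= 1 -> X y) -> measurable X.
Proof.
move=> X01 upX; apply: is_interval_measurable => x y Xx Xy z /andP[xz zy].
apply: upX Xx xz (le_trans zy _).
by have := X01 _ Xy; rewrite /type_space/= in_itv/= => /andP[].
Qed.

(* [P X = 1 - F (inf X)], and [inf X] is a limit of points of [X] from the right,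
   where [F] is continuous. *)
Lemma prob_upper_set_le (X : set R) (M : R) :
  measurable X -> X `<=` @type_space R ->
  (forall x y, X x -> x <= y -> y <= 1 -> X y) ->
  0 <= M -> (forall x, X x -> 1 - F x <= M) -> fine (P X) <= M.
Proof.
move=> mX X01 upX M0 XM.
have [->|/set0P[x0 Xx0]] := eqVneq X set0; first by rewrite measure0.
have lbX : has_lbound X by exists 0 => z /X01; rewrite /type_space/= in_itv/= => /andP[].
pose t := inf X.
have tX z : X z -> t <= z by move=> Xz; exact: ge_inf.
have t1 : t <= 1.
  by rewrite (le_trans (tX _ Xx0))//; have := X01 _ Xx0; rewrite /type_space/= in_itv/= => /andP[].
have PX : (P X <= (1 - F t)%:E)%E.
  rewrite -type_cdf1 -prob_itv_oc//.
  apply: (@le_trans _ _ (P ([set t] `|` `]t, 1]%classic))).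
    rewrite le_measure ?inE//; first exact: measurableU.
    move=> z Xz /=; have := tX _ Xz; rewrite le_eqVlt => /predU1P[->|tz]; first by left.
    by right; rewrite in_itv/= tz; have := X01 _ Xz; rewrite /type_space/= in_itv/= => /andP[].
  rewrite measureU//.
    by rewrite -[leRHS]add0e; apply: leeD => //; have := prob_set1 t => /= ->.
  by rewrite -subset0 => z [/= ->]; rewrite in_itv/= ltxx.
rewrite -lee_fin fineK ?fin_num_measure//; apply: (le_trans PX).
rewrite lee_fin; move: t1; rewrite le_eqVlt => /predU1P[->|t1].
  by rewrite type_cdf1 subrr.
rewrite lerBlDr -lerBlDl.
apply: (cvgr_to_ge (@type_cdf_right_continuous t)).
near=> y.
have ty : t < y by near: y; exact: nbhs_right_gt.
have [z Xz zy] := inf_lt (ex_intro _ x0 Xx0) ty.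
rewrite lerBlDl -lerBlDr; apply: XM; apply: upX Xz (ltW zy) _.
by near: y; exact: nbhs_right_le.
Unshelve. all: by end_near. Qed.

Lemma integrable_survival (D : set R) : measurable D -> (mu D < +oo)%E ->
  mu.-integrable D (EFin \o (fun u => 1 - F u)).
Proof.
move=> mD Doo; apply: measurable_bounded_integrable => //.
  by apply: measurable_funB => //; exact: measurable_type_cdf.
exists 1; split => // M M1 x _ /=.
by rewrite ger0_norm ?subr_ge0 ?type_cdf_le1// (le_trans _ (ltW M1))// gerBl type_cdf_ge0.
Qed.

(** The difference is the integral over [[x, y]] of a nonincreasing function, which lies between its
    end point values. All incentive comparisons below use these bounds in place of derivatives. *)
Lemma survival_integral_bounds (x y : R) : x <= y -> y <= 1 ->
  (y - x) * (1 - F y) <=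
    \int[mu]_(u in `[x, 1]) (1 - F u) - \int[mu]_(u in `[y, 1]) (1 - F u)
  <= (y - x) * (1 - F x).
Proof.
have fin a b : (mu `[a, b]%classic < +oo)%E.
  by rewrite lebesgue_measure_itv/=; case: ifP => // _; rewrite -EFinB ltry.
have int a b := @integrable_survival `[a, b]%classic (measurable_itv _) (fin a b).
move=> xy y1.
have -> : \int[mu]_(u in `[x, 1]) (1 - F u) - \int[mu]_(u in `[y, 1]) (1 - F u) =
    \int[mu]_(u in `[x, y]) (1 - F u).
  rewrite -(Rintegral_itv_obnd_cbnd (r := y)); last first.
    by apply: integrableS (int y 1) => //; exact: subset_itv_oc_cc.
  by rewrite -(@Rintegral_itvB _ _ _ _ y (int x 1)) ?bnd_simp// subKr.
have cst c : \int[mu]_(u in `[x, y]) c = (y - x) * c.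
  rewrite Rintegral_cst//= lebesgue_measure_itv/= mulrC lte_fin.
  by move: xy; rewrite le_eqVlt => /predU1P[->|->]//; rewrite ltxx subrr.
have intc c : mu.-integrable `[x, y]%classic (EFin \o (fun=> c)).
  apply: measurable_bounded_integrable => //; first exact: fin.
  by exists `|c|; split => // N /ltW cN z _ /=.
rewrite -!cst; apply/andP; split; apply: le_Rintegral => //= z.
  by rewrite in_itv/= => /andP[_ zy]; rewrite lerB// type_cdf_le.
by rewrite in_itv/= => /andP[xz _]; rewrite lerB// type_cdf_le.
Qed.

(** The law has no atoms and is carried by [[0, 1]]. The discarded points are 1, where [S_sym] has
    no meaning, and [t], later the threshold, where the favored quality is free. *)
Lemma ae_type (t : R) (Q : R -> Prop) :
  (forall x, 0 <= x -> x < 1 -> x != t -> Q x) -> {ae P, forall x, Q x}.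
Proof.
move=> HQ.
have n1 a : P.-negligible [set a] by apply/negligibleP => //; exact: prob_set1.
have nT : P.-negligible (~` @type_space R).
  apply/negligibleP; last exact: prob_Ntype_space.
  by apply: measurableC; exact: measurable_type_space.
change (P.-negligible (~` [set x | Q x])).
apply: (@negligibleS _ (measurableTypeR R) R P ((~` @type_space R) `|` ([set 1] `|` [set t]))); last first.
  by apply: negligibleU => //; exact: negligibleU.
move=> x /= nQ; apply: contrapT => H; apply: nQ; 
have [xT x1t] : type_space x /\ ~ (x = 1 \/ x = t).
  by split=> [|x1t]; [apply: contrapT => xT; apply: H; left|apply: H; right].
move: xT; rewrite /type_space/= in_itv/= => /andP[x0 x1]; apply: HQ => //.
  by rewrite lt_neqAle x1 andbT; apply/eqP => e; apply: x1t; left.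
by apply/eqP => e; apply: x1t; right.
Qed.

Lemma ae_types2 (Q : R * R -> Prop) :
  (forall x y, 0 <= x <= 1 -> 0 <= y <= 1 -> Q (x, y)) ->
  {ae (P \x P)%E, forall th, Q th}.
Proof.
move=> HQ.
have mC : measurable (~` @type_space R) by apply: measurableC; exact: measurable_type_space.
change ((P \x P)%E.-negligible (~` [set th | Q th])).
apply: (@negligibleS _ _ R (P \x P)%E
    ((~` @type_space R) `*` setT `|` setT `*` (~` @type_space R))).
  move=> [x y] /= nQ; apply: contrapT => /not_orP[/= H1 H2]; apply: nQ; apply: HQ.
    by apply: contrapT => Hx; apply: H1; split => //; rewrite /type_space/= in_itv/=.
  by apply: contrapT => Hx; apply: H2; split => //; rewrite /type_space/= in_itv/=.
apply: negligibleU; apply/negligibleP; try exact: measurableX.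
- apply: (etrans (@product_measure1E _ _ _ _ _ P P _ _ mC measurableT)).
  by have := prob_Ntype_space => /= ->; rewrite mul0e.
- apply: (etrans (@product_measure1E _ _ _ _ _ P P _ _ measurableT mC)).
  by have := prob_Ntype_space => /= ->; rewrite mule0.
Qed.

(** Ex post profits are affine in the indicator of winning, so interim profits depend on the
    opponent only through the winning probability. *)
Lemma expectation_affine_bool (w : R -> bool) (a c : R) :
  measurable (@type_space R `&` [set x | w x]) ->
  \int[P]_(x in @type_space R) (a * (w x)%:R - c) =
    a * fine (P (@type_space R `&` [set x | w x])) - c.
Proof.
set W := _ `&` _ => mW; have mT := measurable_type_space.
have int_cst A k : measurable A -> P.-integrable A (EFin \o (fun=> k)).
  exact: finite_measure_integrable_cst.
have int_W : P.-integrable (@type_space R) (EFin \o \1_W).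
  apply: measurable_bounded_integrable => //.
    by apply: (le_lt_trans (probability_le1 P mT)); exact: ltry.
  exists 1; split => // M M1 x _ /=.
  by rewrite (le_trans _ (ltW M1))// indicE; case: (_ \in _); rewrite ?normr1 ?normr0.
have -> : \int[P]_(x in @type_space R) (a * (w x)%:R - c) =
    \int[P]_(x in @type_space R) (a * \1_W x - c).
  apply: eq_Rintegral => x xT; rewrite indicE /W in_setI xT /=.
  by have -> : (x \in [set x | w x]) = w x by apply/idP/idP; rewrite inE.
rewrite RintegralB//; [|exact: (@integrableZl _ (measurableTypeR R) R P _ mT a _ int_W)|exact: int_cst].
rewrite RintegralZl// Rintegral_cst//=.
have := prob_type_space => /= ->; rewrite mulr1; congr (_ * _ - _).
by rewrite /Rintegral integral_indic// setIidl// => x [].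
Qed.

End TypeDistribution.

(** * Symmetric qualities, the payoff from mimicking a type, and monotone scores *)

Section ScoreCeilingEquilibrium.
Context (R : realType) (P : probability (measurableTypeR R) R) (f : R -> R).
Context (g dg ddg : R -> R) (alpha theta0 : R).
Context (Hf : type_density P f) (Hg : investment_cost g dg ddg).
Context (Halpha : 0 < alpha) (Htheta0 : 0 <= theta0 < 1).

Local Notation F := (type_cdf P).
Local Notation surplus t :=
  (\int[lebesgue_measure]_(u in `[t, 1]) (1 - type_cdf P u)).
Local Notation q_ := (q_sym P dg).
Local Notation S_ := (S_sym P g dg alpha).
Local Notation Sbar := (S_sym P g dg alpha theta0).
Local Notation K := (kickback P g alpha theta0).

Lemma survival01 (t : R) : 0 <= 1 - F t <= 1.
Proof. by rewrite subr_ge0 type_cdf_le1 gerBl type_cdf_ge0. Qed.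

Lemma survival_gt0 (t : R) : 0 <= t -> t < 1 -> 0 < 1 - F t.
Proof. by move=> t0 t1; rewrite subr_gt0 -(type_cdf1 Hf) (type_cdf_lt Hf). Qed.

Lemma surplus_ge0 (t : R) : t <= 1 -> 0 <= surplus t.
Proof. by move=> t1; apply: Rintegral_ge0 => u _; case/andP: (survival01 u). Qed.

Lemma surplus1 : surplus 1 = 0 :> R.
Proof. by rewrite set_itv1 Rintegral_set1. Qed.

Lemma q_sym_ge0 (t : R) : 0 <= q_ t.
Proof. exact: (marginal_cost_inv_ge0 Hg (survival01 t)). Qed.

Lemma q_sym1 : q_ 1 = 0.
Proof. by rewrite /q_sym (type_cdf1 Hf) subrr (marginal_cost_inv0 Hg). Qed.

Lemma q_sym_gt0 (t : R) : 0 <= t -> t < 1 -> 0 < q_ t.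
Proof.
move=> t0 t1; apply: (marginal_cost_inv_gt0 Hg); rewrite survival_gt0//=.
by case/andP: (survival01 t).
Qed.

Lemma q_sym_le (x y : R) : x <= y -> q_ y <= q_ x.
Proof.
move=> xy; apply: (marginal_cost_inv_le Hg).
- by case/andP: (survival01 y).
- by rewrite lerB// type_cdf_le.
- by case/andP: (survival01 x).
Qed.

Lemma q_sym_max (t q : R) : 0 <= q ->
  (1 - F t) * q - g q <= (1 - F t) * q_ t - g (q_ t).
Proof. exact: (marginal_cost_inv_max Hg (survival01 t)). Qed.

(* Payoff of type [th] from outbidding exactly the types above [t] with the
   offer [(q_sym t, S_sym t)]. *)
Definition mimic_profit (t th : R) : R :=
  alpha * ((1 - F t) * (t - th) + surplus t).

(** Multiplying by [1 - F t] clears the denominator in [S_sym t]. At [t = 1] both sides vanish,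
    whatever the value of [S_sym 1]. *)
Lemma mimic_profitE (t th : R) : 0 <= t <= 1 ->
  (1 - F t) * (q_ t - S_ t - alpha * th) - g (q_ t) = mimic_profit t th.
Proof.
rewrite /mimic_profit /S_sym /info_rent => /andP[t0].
rewrite le_eqVlt => /predU1P[->|t1].
  by rewrite q_sym1 (type_cdf1 Hf) surplus1 (icost_0 Hg); ring.
by have /lt0r_neq0 := survival_gt0 t0 t1; set G := 1 - F t => G0; field.
Qed.

(** At winning probability [1 - F t] the quality [q_sym t] is optimal, and a higher score only
    lowers the price. *)
Lemma mimic_profit_ge (t th q s : R) : 0 <= t <= 1 -> 0 <= q -> S_ t <= s ->
  (1 - F t) * (q - s - alpha * th) - g q <= mimic_profit t th.
Proof.
move=> t01 q0 ts; rewrite -mimic_profitE//.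
have := q_sym_max t q0; have /andP[G0 _] := survival01 t.
have := ler_wpM2l G0 ts; lra.
Qed.

(* Division by zero makes [S_sym 1 = - alpha], so [S_sym] is decreasing on the
   closed interval. *)
Lemma S_sym_ge (t : R) : 0 <= t -> t < 1 -> S_ 1 <= S_ t.
Proof.
move=> t0 t1; have G0 := survival_gt0 t0 t1.
have -> : S_ 1 = - alpha.
  by rewrite /S_sym /info_rent q_sym1 (type_cdf1 Hf) (icost_0 Hg) surplus1; ring.
have := @mimic_profitE t 0 _; rewrite t0 (ltW t1) /mimic_profit => /(_ isT) e.
have /andP[_] := survival_integral_bounds P (ltW t1) (lexx 1); rewrite surplus1 => b.
(* Comparison with zero quality makes [(1 - F t) q - g q] nonnegative at [q_sym t]. *)
have := q_sym_max t (lexx 0); rewrite (icost_0 Hg) => m.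
rewrite -(ler_pM2l G0).
have := ler_wpM2l (ltW Halpha) b; nra.
Qed.

Lemma S_sym_lt (x y : R) : 0 <= x -> x < y -> y <= 1 -> S_ y < S_ x.
Proof.
move=> x0; suff lt1 z : x < z -> z < 1 -> S_ z < S_ x.
  move=> xy; rewrite le_eqVlt => /predU1P[y1|]; last exact: lt1.
  (* Only a weak inequality is known at 1, so strictness comes from an intermediate type. *)
  have [m [xm m1]] : exists m : R, x < m /\ m < 1 by exists ((x + 1) / 2); lra.
  by rewrite y1 (le_lt_trans (S_sym_ge _ m1)) ?lt1// (le_trans x0) ?ltW.
move=> xz z1; have z0 := le_trans x0 (ltW xz).
have ex := @mimic_profitE x 0; rewrite x0 (ltW (lt_trans xz z1)) in ex.
have ez := @mimic_profitE z 0; rewrite z0 (ltW z1) in ez.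
move: (ex isT) (ez isT) => {ex ez}; rewrite /mimic_profit => ex ez.
have m := q_sym_max x (q_sym_ge0 z).
have c0 := icost_gt0 Hg (q_sym_gt0 z0 z1).
have I0 := surplus_ge0 (ltW z1).
have /andP[_ Ixz] := survival_integral_bounds P (ltW xz) (ltW z1).
have b0 := survival_gt0 z0 z1.
have ba : 1 - F z < 1 - F x by rewrite ltrD2l ltrN2 (type_cdf_lt Hf)// ltW.
have aI := mulr_ge0 (ltW Halpha) I0.
have := ler_wpM2l (ltW Halpha) Ixz => aIxz.
(* Up to sign, [u] and [v] are the margins of type [z] with quality [q_sym z] at the scores of [z]
   and [x]. Here [u < 0] since the margin must cover a positive investment, and optimality of
   [q_sym x] gives [(1 - F z) u <= (1 - F x) v]. Since [1 - F z < 1 - F x], this forces [u < v]. *)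
pose u := S_ z - q_ z + alpha * z.
pose v := S_ x - q_ z + alpha * z.
suff : u < v by rewrite /u /v; lra.
have u0 : u < 0 by rewrite -(pmulr_rlt0 _ b0) /u; lra.
have uv : (1 - F z) * u <= (1 - F x) * v by rewrite /u /v; lra.
rewrite -(ltr_pM2l (lt_trans b0 ba)); apply: lt_le_trans uv.
by rewrite ltr_nM2r.
Qed.

Lemma S_sym_le (x y : R) : 0 <= x -> x <= y -> y <= 1 -> S_ y <= S_ x.
Proof.
by move=> x0; rewrite le_eqVlt => /predU1P[->//|xy y1]; rewrite ltW ?S_sym_lt.
Qed.

Lemma S_sym_ltE (x y : R) : 0 <= x <= 1 -> 0 <= y <= 1 ->
  (S_ x < S_ y) = (y < x).
Proof.
move=> /andP[x0 x1] /andP[y0 y1]; have [xy|xy] := ltP y x; first exact: S_sym_lt.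
by apply/negbTE; rewrite -leNgt S_sym_le.
Qed.

Lemma S_sym_leE (x y : R) : 0 <= x <= 1 -> 0 <= y <= 1 ->
  (S_ x <= S_ y) = (y <= x).
Proof. by move=> x01 y01; rewrite leNgt S_sym_ltE// -leNgt. Qed.

(** * Types censored at the threshold, and deviations below the ceiling *)

Lemma max_theta01 (t : R) : 0 <= t <= 1 -> 0 <= Num.max theta0 t <= 1.
Proof.
case/andP: Htheta0 => h0 h1 /andP[t0 t1].
by rewrite le_max h0 ge_max (ltW h1).
Qed.

Lemma theta001 : 0 <= theta0 <= 1.
Proof. by case/andP: Htheta0 => -> /ltW. Qed.

(** As [S_sym] is decreasing, capping the score amounts to raising the type to [theta0]. *)
Lemma S_starE (t : R) : 0 <= t <= 1 ->
  S_star P g dg alpha Sbar t = S_ (Num.max theta0 t).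
Proof.
move=> t01; rewrite /S_star; have [tt|tt] := leP theta0 t.
  by apply: min_l; rewrite S_sym_leE// theta001.
by apply: min_r; rewrite S_sym_leE ?theta001// ltW.
Qed.

(** Moving [t] towards [th] changes the surplus integral by at least what the margin term loses. For
    [th < theta0] the payoff decreases in [t] beyond the threshold, so the constraint binds. *)
Lemma mimic_profit_max (t th : R) : theta0 <= t <= 1 -> 0 <= th <= 1 ->
  mimic_profit t th <= mimic_profit (Num.max theta0 th) th.
Proof.
move=> /andP[h0t t1] /andP[th0 th1]; rewrite /mimic_profit ler_pM2l//.
have [hth|thh] := leP theta0 th.
  rewrite subrr mulr0 add0r; have [tth|tht] := leP t th.
    have /andP[_] := survival_integral_bounds P tth th1; lra.
  have /andP[+ _] := survival_integral_bounds P (ltW tht) t1; lra.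
have /andP[+ _] := survival_integral_bounds P h0t t1.
have := type_cdf_le P h0t; nra.
Qed.

Lemma mimic_profit_max_ge0 (th : R) : 0 <= th <= 1 ->
  0 <= mimic_profit (Num.max theta0 th) th.
Proof.
move=> th01; have /andP[_ m1] := max_theta01 th01.
rewrite /mimic_profit mulr_ge0 ?(ltW Halpha)//.
apply: addr_ge0; last exact: surplus_ge0.
by rewrite mulr_ge0// ?subr_ge0 ?le_max ?lexx ?orbT// type_cdf_le1.
Qed.

Lemma outbidding_profit_le (X : set R) (th q s : R) :
  X `<=` @type_space R -> (forall x y, X x -> x <= y -> y <= 1 -> X y) ->
  (forall x, X x -> theta0 <= x /\ S_ x <= s) -> 0 <= th <= 1 -> 0 <= q ->
  (q - s - alpha * th) * fine (P X) - g q <= mimic_profit (Num.max theta0 th) th.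
Proof.
move=> X01 upX Xs th01 q0; set c := q - s - _.
have gq0 := icost_ge0 Hg q0; have V0 := mimic_profit_max_ge0 th01.
have PX0 : 0 <= fine (P X) by rewrite fine_ge0.
(* A nonpositive margin earns nothing. A positive one can be divided out, leaving a bound on [P X]
   that need only be checked at each point of [X]. *)
have [c0|c0] := leP c 0.
  by rewrite lerBlDr (le_trans (mulr_le0_ge0 c0 PX0))// addr_ge0.
rewrite lerBlDr -ler_pdivlMl//; apply: (prob_upper_set_le Hf) => //.
- exact: measurable_upper_set.
- by rewrite mulr_ge0 ?invr_ge0 ?(ltW c0)// addr_ge0.
- move=> x Xx; have [h0x xs] := Xs _ Xx.
  have := X01 _ Xx; rewrite /type_space/= in_itv/= => x01.
  rewrite ler_pdivlMl// -lerBlDr mulrC.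
  apply: le_trans (mimic_profit_ge th x01 q0 xs) _.
  by apply: mimic_profit_max => //; rewrite h0x; case/andP: x01.
Qed.

(** * The kickback and the payoff at the ceiling *)

Lemma max_qualityE (G : R) : 0 < G <= 1 ->
  max_quality (fun q => q - g q / G) =
  marginal_cost_inv dg G - g (marginal_cost_inv dg G) / G.
Proof.
move=> /andP[G0 G1]; have G01 : 0 <= G <= 1 by rewrite ltW.
set p := marginal_cost_inv dg G.
have p0 : 0 <= p by exact: (marginal_cost_inv_ge0 Hg).
have pmax q : 0 <= q -> q - g q / G <= p - g p / G.
  move=> q0; rewrite -(ler_pM2l G0) !mulrBr !(mulrCA G) divff ?gt_eqF// !mulr1.
  exact: (marginal_cost_inv_max Hg G01 q0).
apply: xget_unique => /=; first by split => //; exists p.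
move=> m [[q q0 <-] qmax]; apply/eqP; rewrite eq_le pmax//=.
exact: qmax.
Qed.

(** The two maxima in the kickback are attained at [q_sym 0] and [q_sym theta0]. The second cancels
    against the ceiling, and the coefficients of the surplus combine to [1 / G - (1 - G) / G = 1]
    with [G = 1 - F theta0]. *)
Lemma kickbackE : q_ 0 - g (q_ 0) - Sbar - K = alpha * (theta0 + surplus theta0).
Proof.
case/andP: Htheta0 => h0 h1; have G0 := survival_gt0 h0 h1.
have := @max_qualityE 1; rewrite ltr01 lexx => /(_ isT) e1.
have -> : K = q_ 0 - g (q_ 0) - (q_ theta0 - g (q_ theta0) / (1 - F theta0))
    + alpha * (F theta0 / (1 - F theta0)) * surplus theta0.
  rewrite /kickback max_qualityE; last by rewrite G0; case/andP: (survival01 theta0).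
  congr (_ - _ + _); rewrite /q_sym (type_cdf0 Hf) subr0 -[RHS]mulr1.
  by under eq_fun do rewrite -[g _]divr1; rewrite e1 divr1 mulr1.
rewrite /S_sym /info_rent; have := lt0r_neq0 G0.
set G := 1 - F theta0 => G_neq0; have -> : F theta0 = 1 - G by rewrite /G; ring.
by field.
Qed.

(* Winning against every type at the ceiling, kickback included. *)
Lemma ceiling_profitE (th : R) :
  q_ 0 - Sbar - K - alpha * th - g (q_ 0) =
  alpha * (theta0 - th + surplus theta0).
Proof. have := kickbackE; rewrite !mulrDr mulrN; lra. Qed.

(** A sure winner faces [1 - F 0 = 1], for which [q_sym 0] is the optimal quality. *)
Lemma ceiling_profit_le (th q : R) : 0 <= q ->
  q - Sbar - K - alpha * th - g q <= alpha * (theta0 - th + surplus theta0).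
Proof.
move=> q0; rewrite -ceiling_profitE; have := q_sym_max 0 q0.
rewrite (type_cdf0 Hf); lra.
Qed.

(** * Opponent types outbid by a given score *)

Local Notation S1 := (S_star P g dg alpha Sbar).
Local Notation M := (score_ceiling_auction Sbar K).

Lemma S_star_le (x y : R) : 0 <= x -> x <= y -> y <= 1 -> S1 y <= S1 x.
Proof.
move=> x0 xy y1; have x01 : 0 <= x <= 1 by rewrite x0 (le_trans xy).
have y01 : 0 <= y <= 1 by rewrite y1 (le_trans x0).
rewrite !S_starE// S_sym_leE ?max_theta01//.
by rewrite ge_max !le_max lexx xy orbT.
Qed.

(** The ceiling clause is kept in the set, so a score above the ceiling beats nobody. Ties count
    here but not in [beaten2], as firm 1 is favored. *)
Definition beaten1 (s : R) : set R :=
  @type_space R `&` [set x | S1 x <= s <= Sbar].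

Definition beaten2 (s : R) : set R :=
  @type_space R `&` [set x | S1 x < s <= Sbar].

Lemma beaten1_upper (s x y : R) :
  beaten1 s x -> x <= y -> y <= 1 -> beaten1 s y.
Proof.
rewrite /beaten1 /type_space/= !in_itv/= => -[/andP[x0 x1] /andP[xs ->]] xy y1.
rewrite andbT y1 (le_trans x0 xy); split => //.
by apply: le_trans xs; exact: S_star_le.
Qed.

Lemma beaten2_upper (s x y : R) :
  beaten2 s x -> x <= y -> y <= 1 -> beaten2 s y.
Proof.
rewrite /beaten2 /type_space/= !in_itv/= => -[/andP[x0 x1] /andP[xs ->]] xy y1.
rewrite andbT y1 (le_trans x0 xy); split => //.
by apply: le_lt_trans xs; exact: S_star_le.
Qed.

Lemma measurable_beaten1 (s : R) : measurable (beaten1 s).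
Proof. by apply: measurable_upper_set => [|x y]; [exact: subIsetl|exact: beaten1_upper]. Qed.

Lemma measurable_beaten2 (s : R) : measurable (beaten2 s).
Proof. by apply: measurable_upper_set => [|x y]; [exact: subIsetl|exact: beaten2_upper]. Qed.

Lemma S_star_below_ceiling (x : R) : 0 <= x <= 1 -> S1 x < Sbar ->
  theta0 <= x /\ S_ x = S1 x.
Proof.
move=> x01; rewrite S_starE// S_sym_ltE ?theta001 ?max_theta01//.
by rewrite lt_max ltxx /= => h0x; rewrite max_r ltW.
Qed.

(** The ceiling is excluded because there the favored firm also beats the censored types by the
    tie-breaking rule. *)
Lemma beaten1P (s x : R) : s != Sbar -> beaten1 s x -> theta0 <= x /\ S_ x <= s.
Proof.
rewrite /beaten1 /type_space/= in_itv/= => sn [x01 /andP[xs sS]].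
have [|-> ->//] := S_star_below_ceiling x01.
by rewrite (le_lt_trans xs)// lt_neqAle sn.
Qed.

(** The strict inequality keeps the opponents beaten by firm 2 below the ceiling, even when [s] is
    the ceiling itself. *)
Lemma beaten2P (s x : R) : beaten2 s x -> theta0 <= x /\ S_ x <= s.
Proof.
rewrite /beaten2 /type_space/= in_itv/= => -[x01 /andP[xs sS]].
have [|-> ->] := S_star_below_ceiling x01; first exact: lt_le_trans sS.
by rewrite ltW.
Qed.

Lemma beaten1_ceiling : beaten1 Sbar = @type_space R.
Proof.
by apply/setIidl => x _ /=; rewrite lexx andbT /S_star ge_min lexx orbT.
Qed.

Lemma beaten1_S_sym (t : R) : theta0 < t <= 1 -> beaten1 (S_ t) = `[t, 1]%classic.
Proof.
move=> /andP[ht t1]; have /andP[h0 h1] := theta001.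
have t0 := le_trans h0 (ltW ht).
have t01 : 0 <= t <= 1 by rewrite t0.
rewrite /beaten1; apply/seteqP; split=> x; rewrite /type_space/= !in_itv/=.
  move=> [x01 /andP[+ _]]; rewrite S_starE// S_sym_leE ?max_theta01//.
  by rewrite le_max leNgt ht /= => ->; case/andP: x01.
move=> /andP[tx x1]; have x0 := le_trans t0 tx.
have x01 : 0 <= x <= 1 by rewrite x0.
split => //; rewrite S_starE// !S_sym_leE ?max_theta01 ?theta001//.
by rewrite le_max tx orbT (ltW ht).
Qed.

Lemma beaten2_S_sym (t : R) : theta0 <= t <= 1 -> beaten2 (S_ t) = `]t, 1]%classic.
Proof.
move=> /andP[ht t1]; have /andP[h0 h1] := theta001.
have t0 := le_trans h0 ht.
have t01 : 0 <= t <= 1 by rewrite t0.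
rewrite /beaten2; apply/seteqP; split=> x; rewrite /type_space/= !in_itv/=.
  move=> [x01 /andP[+ _]]; rewrite S_starE// S_sym_ltE ?max_theta01//.
  by rewrite lt_max ltNge ht /= => ->; case/andP: x01.
move=> /andP[tx x1]; have x0 := le_trans t0 (ltW tx).
have x01 : 0 <= x <= 1 by rewrite x0.
split => //; rewrite S_starE// S_sym_ltE ?S_sym_leE ?max_theta01 ?theta001//.
by rewrite lt_max tx orbT.
Qed.

(** * Interim profits and best replies *)

Lemma score_strategy_of (q S : R -> R) (t : R) : score (strategy_of q S t) = S t.
Proof. exact: subKr. Qed.

(** A bid at the ceiling pays the kickback exactly when it wins, so [K] acts as a price cut. *)
Lemma interim_profit1E (q2 : R -> R) (th : R) (b : offer R) :
  interim_profit1 P g alpha M (strategy_of q2 S1) th b =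
  (b.1 - score b - K * (score b == Sbar)%:R - alpha * th) *
    fine (P (beaten1 (score b))) - g b.1.
Proof.
rewrite -(expectation_affine_bool Hf (w := fun x => S1 x <= score b <= Sbar)); last first.
  exact: measurable_beaten1.
apply: eq_Rintegral => x _.
rewrite /profit1 /= /ceiling_win1 /pays_kickback score_strategy_of eq_sym.
have -> : b.2 = b.1 - score b by rewrite /score; ring.
case: eqP => [->|_] /=; last by ring.
by rewrite lexx andbT; ring.
Qed.

Lemma interim_profit2E (q1 : R -> R) (th : R) (b : offer R) :
  interim_profit2 P g alpha M (strategy_of q1 S1) th b =
  (b.1 - score b - alpha * th) * fine (P (beaten2 (score b))) - g b.1.
Proof.
rewrite -(expectation_affine_bool Hf (w := fun x => S1 x < score b <= Sbar)); last first.
  exact: measurable_beaten2.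
apply: eq_Rintegral => x _.
rewrite /profit2 /= /ceiling_win2 score_strategy_of.
have -> : b.2 = b.1 - score b by rewrite /score; ring.
by ring.
Qed.

Lemma interim_profit2_le (q1 : R -> R) (th : R) (b : offer R) :
  0 <= th <= 1 -> 0 <= b.1 ->
  interim_profit2 P g alpha M (strategy_of q1 S1) th b
    <= mimic_profit (Num.max theta0 th) th.
Proof.
move=> th01 b0; rewrite interim_profit2E; apply: outbidding_profit_le => //.
- exact: subIsetl.
- exact: beaten2_upper.
- exact: beaten2P.
Qed.

Lemma interim_profit2_star (q1 : R -> R) (th : R) : 0 <= th <= 1 ->
  interim_profit2 P g alpha M (strategy_of q1 S1) th
    (strategy_of (lc_quality2 P dg theta0) S1 th) =
  mimic_profit (Num.max theta0 th) th.
Proof.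
move=> th01; have m01 := max_theta01 th01.
rewrite interim_profit2E score_strategy_of /= S_starE// /lc_quality2.
rewrite beaten2_S_sym; last by rewrite le_max lexx; case/andP: m01.
by rewrite (prob_gt Hf)//= mulrC mimic_profitE.
Qed.

(** Equilibrium payoff of firm 1: types below the threshold bid the ceiling, the others outbid the
    types above their own. *)
Definition favored_profit (th : R) : R :=
  if th < theta0 then alpha * (theta0 - th + surplus theta0)
  else mimic_profit th th.

Lemma ceiling_profit_le_favored (th : R) : 0 <= th <= 1 ->
  alpha * (theta0 - th + surplus theta0) <= favored_profit th.
Proof.
move=> /andP[th0 th1]; rewrite /favored_profit.
have [//|hth] := ltP th theta0.
rewrite /mimic_profit ler_pM2l// subrr mulr0 add0r.
have /andP[_] := survival_integral_bounds P hth th1.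
have := type_cdf_ge0 P theta0; nra.
Qed.

(** Below the threshold the margin [theta0 - th] is positive, and the ceiling earns it with
    probability 1 instead of [1 - F theta0]. *)
Lemma mimic_profit_le_favored (th : R) : 0 <= th <= 1 ->
  mimic_profit (Num.max theta0 th) th <= favored_profit th.
Proof.
move=> th01; rewrite /favored_profit; have [hth|//] := ltP th theta0.
rewrite /mimic_profit ler_pM2l//.
have := type_cdf_ge0 P theta0; nra.
Qed.

Lemma favored_profit_ge0 (th : R) : 0 <= th <= 1 -> 0 <= favored_profit th.
Proof.
by move=> th01; apply: le_trans (mimic_profit_le_favored th01); exact: mimic_profit_max_ge0.
Qed.

Lemma interim_profit1_le (q2 : R -> R) (th : R) (b : offer R) :
  0 <= th <= 1 -> 0 <= b.1 ->
  interim_profit1 P g alpha M (strategy_of q2 S1) th b <= favored_profit th.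
Proof.
move=> th01 b0; rewrite interim_profit1E; have [->|sS] := eqVneq (score b) Sbar.
  rewrite beaten1_ceiling; have /= -> := prob_type_space Hf; rewrite !mulr1.
  by apply: le_trans (ceiling_profit_le_favored th01); exact: ceiling_profit_le.
(* Off the ceiling no kickback is due; scores above it beat an empty set and obey the same bound. *)
rewrite mulr0 subr0; apply: le_trans (mimic_profit_le_favored th01).
apply: outbidding_profit_le => //.
- exact: subIsetl.
- exact: beaten1_upper.
- by move=> x; exact: beaten1P.
Qed.

Lemma interim_profit1_star (q1 q2 : R -> R) (th : R) :
  lc_quality1 P dg theta0 q1 -> 0 <= th <= 1 -> th != theta0 ->
  0 <= q1 th /\
  interim_profit1 P g alpha M (strategy_of q2 S1) th (strategy_of q1 S1 th) =
  favored_profit th.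
Proof.
move=> Hq1 th01 thn; have [qhi qlo] := Hq1 _ th01.
rewrite interim_profit1E score_strategy_of /= S_starE// /favored_profit.
move: thn; rewrite neq_lt => /orP[lo|hi].
  rewrite lo (max_l (ltW lo)) eqxx mulr1 qlo//; split; first exact: q_sym_ge0.
  rewrite beaten1_ceiling; have /= -> := prob_type_space Hf.
  by rewrite mulr1 ceiling_profitE.
rewrite ltNge (ltW hi)/= (max_r (ltW hi)) qhi//; split; first exact: q_sym_ge0.
rewrite lt_eqF ?S_sym_ltE ?theta001// mulr0 subr0.
rewrite beaten1_S_sym ?hi; last by case/andP: th01.
by rewrite (prob_ge Hf)//= mulrC mimic_profitE.
Qed.

(** * Measurability of the strategies and the induced allocation *)

Lemma measurable_S_star : measurable_fun (@type_space R) S1.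
Proof.
(* Monotonicity is known on [[0, 1]] only; clamping the argument makes it global. *)
apply: (@eq_measurable_fun _ _ R R _ (fun t => S1 (Num.max 0 (Num.min 1 t)))).
  move=> t; rewrite inE /type_space/= in_itv/= => /andP[t0 t1].
  by rewrite min_r// max_r.
apply: nonincreasing_measurable => [|x y xy]; first exact: measurable_type_space.
apply: S_star_le; first by rewrite le_max lexx.
- by rewrite ge_max !le_max lexx /= le_min !ge_min lexx xy !orbT.
- by rewrite ge_max ler01 ge_min lexx.
Qed.

Lemma measurable_lc_quality2 :
  measurable_fun (@type_space R) (lc_quality2 P dg theta0).
Proof.
apply: nonincreasing_measurable => [|x y xy]; first exact: measurable_type_space.
by apply: q_sym_le; rewrite ge_max !le_max lexx xy orbT.
Qed.

Lemma measurable_lc_quality1 (q1 : R -> R) :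
  lc_quality1 P dg theta0 q1 -> measurable_fun (@type_space R) q1.
Proof.
move=> Hq1.
apply: (@eq_measurable_fun _ _ R R _ (fun t => if theta0 < t then q_ t else
    if t < theta0 then q_ 0 else q1 theta0)).
  move=> t; rewrite inE /type_space/= in_itv/= => /Hq1[hi lo].
  by case: ltgtP => [/hi|/lo|->].
apply: measurable_funTS; apply: measurable_fun_ifT.
- exact: measurable_fun_ltr.
- by apply: nonincreasing_measurable => // x y; exact: q_sym_le.
- by apply: measurable_fun_ifT => //; exact: measurable_fun_ltr.
Qed.

Lemma measurable_strategy_of (q S : R -> R) :
  measurable_fun (@type_space R) q -> measurable_fun (@type_space R) S ->
  measurable_fun (@type_space R) (strategy_of q S).
Proof.
move=> mq mS; have mT := @measurable_type_space R.
have mm : measurable_fun (@type_space R) (fun t => q t - S t) by exact: measurable_funB.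
have := measurable_fun_pair ((measurable_restrictT _ mT).1 mq) ((measurable_restrictT _ mT).1 mm).
move=> /(@measurable_funTS _ _ _ _ (@type_space R)).
apply: (@eq_measurable_fun _ _ R (R * R)%type) => t tT.
by rewrite !patchE tT.
Qed.

(** Scores compare as censored types in reverse order, and ties, including those at the ceiling, go
    to firm 1. *)
Lemma win_left_censored (q1 q2 : R -> R) (x y : R) :
  0 <= x <= 1 -> 0 <= y <= 1 ->
  let b1 := strategy_of q1 S1 x in let b2 := strategy_of q2 S1 y in
  win1 M b1 b2 = lc_win1 theta0 x y /\ win2 M b1 b2 = lc_win2 theta0 x y.
Proof.
move=> x01 y01 /=; rewrite /ceiling_win1 /ceiling_win2 !score_strategy_of.
have Sle t : S1 t <= Sbar by rewrite /S_star ge_min lexx orbT.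
rewrite !Sle !andbT !S_starE// S_sym_ltE ?S_sym_leE ?max_theta01//.
have max0 z : theta0 <= Num.max theta0 z by rewrite le_max lexx.
rewrite /lc_win1 /lc_win2 -leNgt; split; first by rewrite ge_max max0.
by rewrite lt_max [_ < theta0]ltNge max0.
Qed.

End ScoreCeilingEquilibrium.

(** * Equilibrium, individual rationality and allocation for almost every type *)

Theorem proposition10 (R : realType)
    (P : probability (measurableTypeR R) R) (f : R -> R)
    (g dg ddg : R -> R) (alpha theta0 : R) (q1 : R -> R)
    (Hf : type_density P f)
    (HJ : regular_types P f)
    (Halpha : 0 < alpha)
    (Hg : investment_cost g dg ddg)
    (Htheta0 : 0 <= theta0 < 1)
    (Hq1 : lc_quality1 P dg theta0 q1) :
  let Sbar := S_sym P g dg alpha theta0 in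
  let K := kickback P g alpha theta0 in
  let M := score_ceiling_auction Sbar K in
  let sigma1 := strategy_of q1 (S_star P g dg alpha Sbar) in
  let sigma2 := strategy_of (lc_quality2 P dg theta0)
                            (S_star P g dg alpha Sbar) in
  [/\ bayes_nash_equilibrium P g alpha M sigma1 sigma2,
      interim_individually_rational P g alpha M sigma1 sigma2 &
      induces_outcome P M sigma1 sigma2 (lc_win1 theta0) (lc_win2 theta0)].
Proof.
move=> Sbar K M sigma1 sigma2.
have mS := measurable_S_star Hf Hg Halpha Htheta0.
have star1 th := interim_profit1_star Hf Hg Halpha Htheta0
  (lc_quality2 P dg theta0) (th := th) Hq1.
have star2 th := interim_profit2_star Hf Hg Halpha Htheta0 q1 (th := th).
split.
- split.
  + exact: (measurable_strategy_of (measurable_lc_quality1 Hg Hq1) mS).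
  + exact: (measurable_strategy_of (measurable_lc_quality2 P theta0 Hg) mS).
  + apply: (ae_type Hf (t := theta0)) => th th0 th1 thn.
    have th01 : 0 <= th <= 1 by rewrite th0 ltW.
    have [q0 e] := star1 _ th01 thn.
    by split => // b b0; rewrite [leRHS]e; exact: (interim_profit1_le Hf Hg Halpha Htheta0).
  + apply: (ae_type Hf (t := theta0)) => th th0 th1 thn.
    have th01 : 0 <= th <= 1 by rewrite th0 ltW.
    split => [|b b0]; first exact: (q_sym_ge0 _ Hg).
    by rewrite [leRHS](star2 _ th01); exact: (interim_profit2_le Hf Hg Halpha Htheta0).
- split; apply: (ae_type Hf (t := theta0)) => th th0 th1 thn;
      have th01 : 0 <= th <= 1 by rewrite th0 ltW.
  + by have [_ ->] := star1 _ th01 thn; exact: (favored_profit_ge0 _ Halpha Htheta0).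
  + by rewrite (star2 _ th01); exact: (mimic_profit_max_ge0 _ Halpha Htheta0).
- apply: (ae_types2 Hf) => x y x01 y01.
  exact: (win_left_censored Hf Hg Halpha Htheta0).
Qed.
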